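(* For any prime $p\ge 5$, \[ \sum_{k=0}^{p-1}\frac{4k+1}{81^k}\gamma_k \equiv \left(\frac{-3}{p}\right)p\pmod{p^3}. \]
   Context: For $n\ge 0$, the Almkvist--Zudilin numbers are \[ \gamma_n=\sum_{j=0}^{n}(-1)^{n-j}\frac{3^{n-3j}(3j)!}{(j!)^3}\binom{n}{3j}\binom{n+j}{j}. \] $\left(\frac{\cdot}{p}\right)$ denotes the Legendre symbol. *)

(* Defs.v *)
From mathcomp Require Import all_boot all_order all_algebra.

Set Implicit Arguments.
Unset Strict Implicit.
Unset Printing Implicit Defensive.

Import GRing.Theory Num.Theory.
Local Open Scope ring_scope.

(* Almkvist-Zudilin numbers. The exponent of 3 is an integer: it is negative
   when 3 j > n, where 'C(n, 3 j) = 0 anyway. *)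
Definition az_number (n : nat) : rat :=
  \sum_(0 <= j < n.+1)
    (-1) ^+ (n - j) * (3 ^ (n%:Z - (3 * j)%:Z) * (3 * j)`!%:R / j`!%:R ^+ 3)
      * 'C(n, 3 * j)%:R * 'C(n + j, j)%:R.

(* Intended for p an odd prime. *)
Definition legendre (a : int) (p : nat) : int :=
  if (p %| a)%Z then 0
  else if [exists x : 'I_p, ((x%:Z) ^+ 2 == a %[mod p])%Z] then 1
  else -1.

(* Congruence of rationals modulo m: a - b = m * c for some rational c whose
   reduced denominator is coprime to m. For m = p ^ r with r > 0 this says
   that a - b lies in p ^ r Z_(p). *)
Definition rat_congr (m : nat) (a b : rat) : Prop :=
  exists2 c : rat, a - b = m%:R * c & coprimez (denq c) m.

(* Main.v *)
(* Zeilberger's algorithm shows that the defining sum of the Almkvist--Zudilin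
   numbers and the Chan--Zudilin sum
     \sum_i (-27)^(n-i) (n+3i)! / (i!^4 (n-i)!)
   satisfy the same second order recurrence. With the second form, the sum over
   k telescopes for each fixed i, leaving
     p 3^(1-p) \sum_(i<p) (-27)^-i U_i W_i(p) / i!^4,
   where U_i = \prod_(1<=t<=i) (p^2 - t^2) is (-1)^i i!^2 modulo p^2 and
   W_i(x) = \prod_(i<t<=3i) (x + t). As W_i has integer coefficients,
   W_i(p) = 3 W_i(-p) - 2 W_i(-2p) modulo p^2. At x = -N, for N = p and N = 2p,
   the sum is 3^(1-N) \sum_(k<N) binom(2k,k) exactly:
   multiplied by 3^(N-1), both have generating function
     z / ((1-z) sqrt(1-4z))
   in N, which amounts to a common three-term recurrence. With chi the nontrivial
   character modulo 3,
     \sum_(k<N) binom(2k,k) = \sum_(k<N) binom(2N,k) chi(N-k),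
   and (1+X)^p = 1 + X^p modulo p makes this chi(p), respectively 3 chi(p),
   modulo p^2. With u = 3^(1-p) the total is p chi(p) (3u^2 - 2u^3) modulo p^3,
   and 3u^2 - 2u^3 = 1 - (u-1)^2 (2u+1) while p divides u - 1. *)
Require Import Defs.
From mathcomp Require Import all_boot all_order all_algebra.
From mathcomp Require Import all_solvable all_field.
From mathcomp Require Import ring zify.

Import GRing.Theory Num.Theory.
Local Open Scope ring_scope.

(** * The two hypergeometric sums and their common recurrence *)

(* 1 / (n - m)!, extended by 0 so that its recurrences hold for all n and m. *)
Definition inv_fact_sub (n m : nat) : rat :=
  if (m <= n)%N then ((n - m)`!%:R)^-1 else 0.

Lemma natr_fact_neq0 n : (n`!%:R : rat) != 0.
Proof. by rewrite pnatr_eq0 -lt0n fact_gt0. Qed.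

Lemma inv_fact_sub_gt n m : (n < m)%N -> inv_fact_sub n m = 0.
Proof. by rewrite /inv_fact_sub ltnNge => /negbTE->. Qed.

Lemma inv_fact_subS n m :
  inv_fact_sub n m.+1 = (n%:R - m%:R) * inv_fact_sub n m.
Proof.
rewrite /inv_fact_sub; case: (ltngtP m n) => [lt_mn|lt_nm|->].
- rewrite -natrB 1?ltnW // -(subnSK lt_mn) factS natrM invfM mulVKf //.
  by rewrite pnatr_eq0.
- by rewrite mulr0.
- by rewrite subrr mul0r.
Qed.

Lemma inv_fact_sub_recl n m :
  inv_fact_sub n m = (n%:R + 1 - m%:R) * inv_fact_sub n.+1 m.
Proof.
by rewrite natr1 -inv_fact_subS /inv_fact_sub ltnS subSS.
Qed.

(* The summand of [az_number], with the binomials expanded; keeping the inverse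
   factorial in [inv_fact_sub] makes the formula valid beyond the support. *)
Definition az_term (n j : nat) : rat :=
  (-3) ^+ n * (- 27^-1) ^+ j * (n + j)`!%:R / j`!%:R ^+ 4
    * inv_fact_sub n (3 * j).

Definition az_term_alt (n i : nat) : rat :=
  (-27) ^+ n * (- 27^-1) ^+ i * (n + 3 * i)`!%:R / i`!%:R ^+ 4
    * inv_fact_sub n i.

Definition az_rec (u0 u1 u2 : rat) (n : nat) : rat :=
  (n%:R + 2) ^+ 3 * u2
  + (2 * n%:R + 3) * (7 * n%:R ^+ 2 + 21 * n%:R + 17) * u1
  + 81 * (n%:R + 1) ^+ 3 * u0.

(* The coefficients of the Zeilberger certificates [az_cert], [az_cert_alt] have
   their own names because unification may unfold large numerals in [rat]. *)
Definition az_cert_coef (n : nat) : rat := - 324 * (4 * n%:R + 5).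

(** The factor [j ^ 4] gives the boundary value 0 at [j = 0]. The three shifted terms are all
    polynomial multiples of the inverse factorial at [n.+2]. *)
Definition az_cert (n j : nat) : rat :=
  az_cert_coef n * (j%:R ^+ 4 *
  ((-3) ^+ n * (- 27^-1) ^+ j * (n + j)`!%:R / j`!%:R ^+ 4
    * inv_fact_sub n.+2 (3 * j))).

Definition az_cert_coef_alt (n : nat) : rat := - 2916 * (4 * n%:R + 7).

Definition az_cert_alt (n i : nat) : rat :=
  az_cert_coef_alt n * (i%:R ^+ 4 *
  ((-27) ^+ n * (- 27^-1) ^+ i * (n + 3 * i)`!%:R / i`!%:R ^+ 4
    * inv_fact_sub n.+2 i)).

Lemma pow4_div_factS (j : nat) :
  j.+1`!%:R ^- 4 = (1 + j%:R) ^- 4 * j`!%:R ^- 4 :> rat.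
Proof. by rewrite factS natrM exprMn invfM nat1r. Qed.

Lemma nat1r_pow4K (j : nat) (x : rat) : (1 + j%:R) ^+ 4 * ((1 + j%:R) ^- 4 * x) = x.
Proof. by rewrite mulVKf // expf_neq0 // nat1r pnatr_eq0. Qed.

Lemma ratS k : (k.+1%:R : rat) = 1 + k%:R.
Proof. by rewrite nat1r. Qed.

Lemma az_term_rec n j :
  az_rec (az_term n j) (az_term n.+1 j) (az_term n.+2 j) n
    = az_cert n j.+1 - az_cert n j.
Proof.
rewrite /az_rec /az_term /az_cert /az_cert_coef.
rewrite !(addSn, addnS) mulnS !add3n !(inv_fact_subS n.+2).
rewrite (inv_fact_sub_recl n) (inv_fact_sub_recl n.+1).
rewrite pow4_div_factS [(n + j).+2`!]factS [(n + j).+1`!]factS !natrM.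
rewrite !(exprS _ n.+1) !(exprS _ n) (exprS _ j).
rewrite !(ratS j, ratS (n + j), ratS (n + j).+1, ratS n.+1, ratS n).
rewrite !(ratS (3 * j).+1, ratS (3 * j)) natrD (natrM _ 3 j).
set f := (n + j)`!%:R; set g := j`!%:R ^- 4; set P := (-3) ^+ n.
set w := (- 27^-1) ^+ j; set y := inv_fact_sub _ _.
(* Writing [g] as [(1 + j) ^ 4 * h] removes the only denominator that depends on [j]; a polynomial
   identity remains. *)
have := nat1r_pow4K j g.
generalize ((1 + j%:R) ^- 4 * g) => h <-.
by field.
Qed.

Lemma az_term_alt_rec n j :
  az_rec (az_term_alt n j) (az_term_alt n.+1 j) (az_term_alt n.+2 j) n
    = az_cert_alt n j.+1 - az_cert_alt n j.
Proof.
rewrite /az_rec /az_term_alt /az_cert_alt /az_cert_coef_alt.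
rewrite mulnS add3n !(addSn, addnS) !(inv_fact_subS n.+2).
rewrite (inv_fact_sub_recl n) (inv_fact_sub_recl n.+1).
rewrite pow4_div_factS [(_ + _).+3`!]factS [(_ + _).+2`!]factS [(_ + _).+1`!]factS.
rewrite !natrM !(exprS _ n.+1) !(exprS _ n) (exprS _ j).
rewrite !(ratS j, ratS (n + 3 * j), ratS (n + 3 * j).+1, ratS (n + 3 * j).+2).
rewrite !(ratS n.+1, ratS n) natrD (natrM _ 3 j).
set f := (n + 3 * j)`!%:R; set g := j`!%:R ^- 4; set P := (-27) ^+ n.
set w := (- 27^-1) ^+ j; set y := inv_fact_sub _ _.
have := nat1r_pow4K j g.
generalize ((1 + j%:R) ^- 4 * g) => h <-.
by field.
Qed.

Lemma sum_nat_widen0 (V : nmodType) (F : nat -> V) (m n : nat) :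
  (m <= n)%N -> (forall j, (m <= j)%N -> F j = 0) ->
  \sum_(0 <= j < n) F j = \sum_(0 <= j < m) F j.
Proof.
move=> le_mn F0; rewrite (big_cat_nat (n := m)) //= [X in _ + X]big_nat_cond.
by rewrite [X in _ + X]big1 ?addr0 // => j /andP[/andP[/F0]].
Qed.

(** Summing the certificate identity over [j <= n + 2] telescopes, with both boundary values zero.
    The three sums can share one range because [t] vanishes beyond its support. *)
Lemma az_sum_rec (t c : nat -> nat -> rat) :
  (forall n, c n 0%N = 0) -> (forall n m, (n.+2 < m)%N -> c n m = 0) ->
  (forall n m, (n < m)%N -> t n m = 0) ->
  (forall n j, az_rec (t n j) (t n.+1 j) (t n.+2 j) n = c n j.+1 - c n j) ->
  forall n, az_rec (\sum_(0 <= j < n.+1) t n j) (\sum_(0 <= j < n.+2) t n.+1 j)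
    (\sum_(0 <= j < n.+3) t n.+2 j) n = 0.
Proof.
move=> c0 c_big t_big tE n.
have <- : \sum_(0 <= j < n.+3) t n j = \sum_(0 <= j < n.+1) t n j.
  by apply: sum_nat_widen0 => [|j /t_big //]; lia.
have <- : \sum_(0 <= j < n.+3) t n.+1 j = \sum_(0 <= j < n.+2) t n.+1 j.
  by apply: sum_nat_widen0 => [|j /t_big //]; lia.
rewrite /az_rec !mulr_sumr -!big_split /=.
rewrite (eq_bigr (fun j => c n j.+1 - c n j)) => [|j _]; last exact: tE.
by rewrite telescope_sumr // c_big // c0 subr0.
Qed.

Lemma az_rec_unique (u v : nat -> rat) :
  u 0%N = v 0%N -> u 1%N = v 1%N ->
  (forall n, az_rec (u n) (u n.+1) (u n.+2) n = 0) ->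
  (forall n, az_rec (v n) (v n.+1) (v n.+2) n = 0) -> u =1 v.
Proof.
move=> uv0 uv1 uE vE n.
suff [] : u n = v n /\ u n.+1 = v n.+1 by [].
elim: n => [//|n [IH0 IH1]]; split=> //.
have := uE n; rewrite -(vE n) /az_rec IH0 IH1 => /addIr /addIr /mulfI; apply.
by rewrite expf_neq0 // -natrD pnatr_eq0 addn2.
Qed.

Lemma az_numberE n : az_number n = \sum_(0 <= j < n.+1) az_term n j.
Proof.
rewrite /az_number !big_mkord; apply: eq_bigr => -[j /=]; rewrite ltnS => le_jn _.
rewrite /az_term /inv_fact_sub; case: leqP => [le3|gt3]; last first.
  by rewrite bin_small // !mulr0 mul0r.
have -> : (-1) ^+ (n - j) = (-1) ^+ n * (-1) ^+ j :> rat.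
  by rewrite -{2}(subnK le_jn) exprD -mulrA -expr2 sqrr_sign mulr1.
have -> : 3 ^ (n%:Z - (3 * j)%:Z) = 3 ^+ n * (27^-1) ^+ j :> rat.
  by rewrite expfzDr // -invr_expz -!exprnP exprM exprVn.
have -> : ('C(n, 3 * j)%:R : rat) = n`!%:R / ((3 * j)`!%:R * (n - 3 * j)`!%:R).
  apply: (canRL (mulfK _)); first by rewrite mulf_neq0 ?natr_fact_neq0.
  by rewrite -!natrM bin_fact.
have -> : ('C(n + j, j)%:R : rat) = (n + j)`!%:R / (j`!%:R * n`!%:R).
  apply: (canRL (mulfK _)); first by rewrite mulf_neq0 ?natr_fact_neq0.
  by rewrite -!natrM -{2}(addnK j n) bin_fact ?leq_addl.
have -> : (-3) ^+ n = (-1) ^+ n * 3 ^+ n :> rat by rewrite -exprMn mulN1r.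
have -> : (- 27^-1) ^+ j = (-1) ^+ j * 27^-1 ^+ j :> rat.
  by rewrite -exprMn mulN1r.
have nz3 := natr_fact_neq0 (3 * j); have nzj := natr_fact_neq0 j.
have nzn := natr_fact_neq0 n; have nzd := natr_fact_neq0 (n - 3 * j).
by field; rewrite nz3 nzj nzn nzd.
Qed.

Lemma mul_pow4_0 (c x : rat) : c * (0%:R ^+ 4 * x) = 0.
Proof. by rewrite expr0n mul0r mulr0. Qed.

Lemma mul_chain_0r (c x y : rat) : c * (x * (y * 0)) = 0.
Proof. by rewrite !mulr0. Qed.

Lemma az_number_alt n : az_number n = \sum_(0 <= i < n.+1) az_term_alt n i.
Proof.
rewrite az_numberE; move: n; apply: az_rec_unique.
- by rewrite !big_nat1 /az_term /az_term_alt /= !mulr1.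
- have sum2 (F : nat -> rat) : \sum_(0 <= j < 2) F j = F 0%N + F 1%N.
    by rewrite big_nat_recr //= big_nat1.
  rewrite !sum2 /az_term /az_term_alt !muln0 !addn0.
  rewrite [inv_fact_sub 1 (3 * 1)]inv_fact_sub_gt //.
- apply: (@az_sum_rec _ az_cert).
  + by move=> n; exact: mul_pow4_0.
  + move=> n m lt_nm; rewrite /az_cert inv_fact_sub_gt; last lia.
    exact: mul_chain_0r.
  + move=> n m lt_nm; rewrite /az_term inv_fact_sub_gt; last lia.
    exact: mulr0.
  + exact: az_term_rec.
- apply: (@az_sum_rec _ az_cert_alt).
  + by move=> n; exact: mul_pow4_0.
  + move=> n m lt_nm; rewrite /az_cert_alt inv_fact_sub_gt; last lia.
    exact: mul_chain_0r.
  + move=> n m lt_nm; rewrite /az_term_alt inv_fact_sub_gt; last lia.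
    exact: mulr0.
  + exact: az_term_alt_rec.
Qed.

(** * Summation over k *)

(** Gosper summation: the right-hand side is an antidifference of the summand and vanishes at
    [n = 0]. Its powers of [- 3^-1] come from the ratio [-27 / 81]. *)
Lemma sum_az_term_alt n i :
  \sum_(0 <= k < n) (4 * k + 1)%:R / 81 ^+ k * az_term_alt k i =
  -3 * (- 3^-1) ^+ n * (- 27^-1) ^+ i * (n + 3 * i)`!%:R / i`!%:R ^+ 4
    * inv_fact_sub n i.+1.
Proof.
elim: n => [|n IHn].
  by rewrite big_geq // [inv_fact_sub _ _]inv_fact_sub_gt // mulr0.
rewrite big_nat_recr //= {}IHn /az_term_alt !(inv_fact_subS _ i).
rewrite (inv_fact_sub_recl n i) addSn factS natrM (ratS (n + 3 * i)) (ratS n) (exprS _ n).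
rewrite !natrD.
have -> : (-27) ^+ n = 81 ^+ n * (- 3^-1) ^+ n :> rat.
  by rewrite -exprMn; congr (_ ^+ _); field.
have : (81 ^+ n : rat) != 0 by rewrite expf_neq0.
set x := 81 ^+ n; set y := (- 3^-1) ^+ n; set z := (- 27^-1) ^+ i.
set f := (n + _)`!%:R; set g := (_ ^- 4); set r := inv_fact_sub _ _ => nzx.
rewrite -!mulrA [x^-1 * _]mulrCA !mulrA; clearbody x y z f g r.
by field.
Qed.

Lemma fact_add_prod (N k m : nat) : (k <= m)%N ->
  (N + m)`!%:R = (N + k)`!%:R * \prod_(k.+1 <= t < m.+1) (N%:R + t%:R) :> rat.
Proof.
move=> /subnK <-; elim: (m - k)%N => [|d IHd].
  by rewrite big_geq // mulr1.
rewrite big_nat_recr ?ltnS ?leq_addl //= mulrA -IHd addSn addnS factS natrM mulrC.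
by rewrite -natrD addnS.
Qed.

(** For [i < N] the left side is the product of the integers from [N - i] to [N + i], whose factors
    pair off around [N]; for [i >= N] both sides are 0. *)
Lemma fact_inv_fact_sub_prod (N i : nat) :
  (N + i)`!%:R * inv_fact_sub N i.+1
    = N%:R * \prod_(1 <= t < i.+1) (N%:R ^+ 2 - t%:R ^+ 2).
Proof.
elim: i => [|i IHi].
  rewrite big_geq // mulr1 addn0 inv_fact_subS /inv_fact_sub /= !subn0 subr0.
  by rewrite mulrCA mulfV ?mulr1 ?natr_fact_neq0.
rewrite big_nat_recr //= mulrA -IHi inv_fact_subS addnS factS natrM.
rewrite -addnS natrD; ring.
Qed.

Lemma sum_az_number (N : nat) :
  \sum_(0 <= k < N) (4 * k + 1)%:R / 81 ^+ k * az_number k =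
  N%:R * (-3 * (- 3^-1) ^+ N) * \sum_(0 <= i < N)
   ((- 27^-1) ^+ i * (\prod_(1 <= t < i.+1) (N%:R ^+ 2 - t%:R ^+ 2))
     * (\prod_(i.+1 <= t < (3 * i).+1) (N%:R + t%:R)) / i`!%:R ^+ 4).
Proof.
transitivity (\sum_(0 <= i < N) \sum_(0 <= k < N)
   (4 * k + 1)%:R / 81 ^+ k * az_term_alt k i).
  rewrite exchange_big /= !big_mkord; apply: eq_bigr => -[k /= lt_kN] _.
  rewrite -mulr_sumr az_number_alt; congr (_ * _); rewrite -?[RHS]big_mkord.
  apply/esym/sum_nat_widen0 => // j lt_kj.
  by rewrite /az_term_alt inv_fact_sub_gt // mulr0.
rewrite mulr_sumr; apply: eq_bigr => i _.
rewrite sum_az_term_alt (@fact_add_prod N i (3 * i)); last by rewrite leq_pmull.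
have := fact_inv_fact_sub_prod N i.
set a := (N + i)`!%:R; set b := inv_fact_sub _ _; set c := \prod_(1 <= t < _) _.
set d := \prod_(i.+1 <= t < _) _; set e := _ ^- 4; set x := _ ^+ N; set y := _ ^+ i => E.
transitivity (-3 * x * y * d * e * (a * b)); first by ring.
by rewrite E; ring.
Qed.

(** * Trinomial coefficients and partial sums of central binomial coefficients *)

(** This is [3^(n-3i)] times the trinomial coefficient [(n-i)! / (i! i! (n-3i)!)]. Summed over [i],
    its generating function in [n] is [((1-3z)^2 - 4z^3)^(-1/2)], and
    [(1-3z)^2 - 4z^3 = (1-z)^2 (1-4z)]. *)
Definition trinomial_term (n i : nat) : rat :=
  3 ^+ n * 27^-1 ^+ i * (n - i)`!%:R / i`!%:R ^+ 2 * inv_fact_sub n (3 * i).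

Lemma trinomial_term_gt n i : (n < 3 * i)%N -> trinomial_term n i = 0.
Proof. by move=> lt_n; rewrite /trinomial_term inv_fact_sub_gt // mulr0. Qed.

Lemma trinomial_term_ffact n i :
  trinomial_term n i = 3 ^+ n * 27^-1 ^+ i * ((n - i) ^_ (2 * i))%:R / i`!%:R ^+ 2.
Proof.
have [lt_n | le_n] := ltnP n (3 * i).
  rewrite trinomial_term_gt // ffact_small ?mulr0 ?mul0r //; lia.
rewrite /trinomial_term /inv_fact_sub le_n.
have -> : (n - 3 * i = n - i - 2 * i)%N by lia.
have le_2i : (2 * i <= n - i)%N by lia.
rewrite -(ffact_fact le_2i) natrM.
have := natr_fact_neq0 (n - i - 2 * i); have := natr_fact_neq0 i.
set a := i`!%:R; set b := (_ - _)`!%:R; set c := _ ^+ n; set d := _ ^+ i.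
set e := (_ ^_ _)%:R.
clearbody a b c d e => nza nzb; field; by rewrite nza nzb.
Qed.

Lemma trinomial_term_rec n i :
  (n%:R + 2) * trinomial_term n.+2 i.+1 - (5 * n%:R + 8) * trinomial_term n.+1 i.+1
    + (4 * n%:R + 6) * trinomial_term n i.+1
  = - 2 * (n%:R - 3 * i.+1%:R) * trinomial_term n i.+1
    - - 2 * (n%:R - 3 * i%:R) * trinomial_term n i.
Proof.
(* The truncated [n - i.+1] is a true difference only for [i < n]. Otherwise every term is 0, the
   last because [n - 3i] turns [inv_fact_sub n (3 * i)] into [inv_fact_sub n (3 * i).+1]. *)
have [lt_in | le_ni] := ltnP i n; last first.
  have z k : (k <= n.+2)%N -> trinomial_term k i.+1 = 0.
    by move=> le_k; apply: trinomial_term_gt; lia.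
  have E : (n%:R - 3 * i%:R) * trinomial_term n i = 0.
    rewrite /trinomial_term -natrM mulrCA -inv_fact_subS.
    by rewrite inv_fact_sub_gt ?mulr0 //; lia.
  rewrite z // z // z; last lia.
  by rewrite -(mulrA _ _ (trinomial_term n i)) E !mulr0; ring.
have [m Dn] : exists m, n = (i.+1 + m)%N by exists (n - i.+1)%N; lia.
rewrite /trinomial_term.
have -> : (n.+2 - i.+1 = m.+2)%N by lia.
have -> : (n.+1 - i.+1 = m.+1)%N by lia.
have -> : (n - i.+1 = m)%N by lia.
have -> : (n - i = m.+1)%N by lia.
rewrite (inv_fact_sub_recl n) (inv_fact_sub_recl n (3 * i)).
rewrite !(inv_fact_sub_recl n.+1) mulnS add3n !(inv_fact_subS n.+2).
have -> : i.+1`!%:R ^- 2 = (1 + i%:R) ^- 2 * i`!%:R ^- 2 :> rat.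
  by rewrite factS natrM exprMn invfM ratS.
rewrite [m.+2`!]factS [m.+1`!]factS !natrM (exprS _ n.+1) !(exprS _ n) (exprS _ i).
rewrite !(ratS n.+1, ratS n, ratS (3 * i).+2, ratS (3 * i).+1, ratS (3 * i)).
rewrite !(ratS m.+1, ratS m, ratS i) (natrM _ 3 i).
have -> : n%:R = 1 + i%:R + m%:R :> rat by rewrite Dn natrD ratS.
set f := m`!%:R; set g := i`!%:R ^- 2; set P := 3 ^+ n.
set w := 27^-1 ^+ i; set y := inv_fact_sub _ _.
have : (1 + i%:R) ^+ 2 * ((1 + i%:R) ^- 2 * g) = g.
  by rewrite mulVKf // expf_neq0 // nat1r pnatr_eq0.
generalize ((1 + i%:R) ^- 2 * g) => h <-.
by field.
Qed.

Lemma central_bin_rec n :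
  n.+1%:R * 'C(2 * n.+1, n.+1)%:R = 2 * (2 * n%:R + 1) * 'C(2 * n, n)%:R :> rat.
Proof.
have binE k : 'C(2 * k, k)%:R = (2 * k)`!%:R / k`!%:R ^+ 2 :> rat.
  apply: (canRL (mulfK _)); first by rewrite expf_neq0 ?natr_fact_neq0.
  rewrite -natrX -natrM; congr _%:R.
  have le_k : (k <= 2 * k)%N by lia.
  rewrite -(bin_fact le_k); congr (_ * (_ * _`!))%N; lia.
rewrite !binE mulnS add2n 2!factS factS !natrM.
rewrite (ratS (2 * n).+1) (ratS (2 * n)) (ratS n) natrM.
have := natr_fact_neq0 n.
have : (1 + n%:R : rat) != 0 by rewrite nat1r pnatr_eq0.
set a := (_)`!%:R; set b := _`!%:R; clearbody a b; move: (n%:R : rat) => x nzx nzb.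
by field; rewrite nzx nzb.
Qed.

Definition trinomial_sum (n : nat) : rat :=
  \sum_(0 <= i < n.+1) trinomial_term n i.

(** Coefficientwise, this is [(1 - 5z + 4z^2) F' = (3 - 6z) F] for [F = 1 / ((1-z) sqrt(1-4z))]. *)
Lemma trinomial_sum_rec n :
  (n%:R + 2) * trinomial_sum n.+2 - (5 * n%:R + 8) * trinomial_sum n.+1
    + (4 * n%:R + 6) * trinomial_sum n = 0.
Proof.
rewrite /trinomial_sum.
have <- : \sum_(0 <= j < n.+3) trinomial_term n j
    = \sum_(0 <= j < n.+1) trinomial_term n j.
  by apply: sum_nat_widen0 => [|j le_j]; rewrite ?trinomial_term_gt //; lia.
have <- : \sum_(0 <= j < n.+3) trinomial_term n.+1 j
    = \sum_(0 <= j < n.+2) trinomial_term n.+1 j.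
  by apply: sum_nat_widen0 => [|j le_j]; rewrite ?trinomial_term_gt //; lia.
pose g i := - 2 * (n%:R - 3 * i%:R) * trinomial_term n i.
have t0 k : trinomial_term k 0 = 3 ^+ k.
  by rewrite trinomial_term_ffact muln0 ffactn0 fact0 expr0 expr1n divr1 !mulr1.
rewrite !mulr_sumr.
(* The column [i = 0] contributes [- 2 n 3^n], which is [g 0], and cancels the lower boundary term
   of the telescoping sum. *)
rewrite -sumrB -big_split /= big_nat_recl //.
rewrite (eq_bigr (fun j => g j.+1 - g j)) => [|j _]; last exact: trinomial_term_rec.
rewrite telescope_sumr // /g (trinomial_term_gt n n.+2); last lia.
by rewrite !t0 !(exprS _ n.+1) !(exprS _ n); ring.
Qed.

(** The recurrence rearranges to [(n+2) (S(n+2) - S(n+1)) = (4n+6) (S(n+1) - S(n))]. The central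
    binomial coefficients obey the same first-order recurrence, so they are the increments. *)
Lemma trinomial_sumE n :
  trinomial_sum n = \sum_(0 <= k < n.+1) 'C(2 * k, k)%:R.
Proof.
suff stepE k : trinomial_sum k.+1 - trinomial_sum k = 'C(2 * k.+1, k.+1)%:R.
  elim: n => [|n IHn].
    rewrite /trinomial_sum !big_nat1 trinomial_term_ffact muln0 ffactn0 bin0.
    by rewrite fact0 !expr0 expr1n divr1 !mulr1.
  by rewrite big_nat_recr //= -IHn -stepE addrC subrK.
elim: k => [|k IHk].
  rewrite /trinomial_sum big_nat_recr //= !big_nat1 !trinomial_term_ffact.
  by rewrite !muln0 !ffactn0 fact0 ffact_small //.
have := trinomial_sum_rec k.
have := central_bin_rec k.+1.
have := IHk.
move: (trinomial_sum k) (trinomial_sum k.+1) (trinomial_sum k.+2) => u v w.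
move=> <- E1 E2; apply: (@mulfI _ k.+2%:R); first by rewrite pnatr_eq0.
apply: subr0_eq; rewrite E1 -E2 !ratS; ring.
Qed.

(** * Central binomial sums and the character modulo 3 *)

Definition chi3 (n : nat) : int :=
  if (n %% 3 == 1)%N then 1 else if (n %% 3 == 2)%N then -1 else 0.

Lemma chi3_add3 n : chi3 n.+3 = chi3 n.
Proof. by rewrite /chi3 -addn3 modnDr. Qed.

Lemma chi3_sum3 n : chi3 n + chi3 n.+1 + chi3 n.+2 = 0.
Proof.
elim: n => [//|n IHn].
by rewrite chi3_add3 -[RHS]IHn addrC addrA.
Qed.

Lemma chi3_sum_mul3 m n : ~~ (3 %| n)%N ->
  chi3 m + chi3 (m + n) + chi3 (m + 2 * n) = 0.
Proof.
have chi3_mod k l : chi3 (k + l) = chi3 (k + l %% 3) by rewrite /chi3 modnDmr.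
rewrite /dvdn chi3_mod (chi3_mod m (2 * n)%N) -modnMmr.
case: (n %% 3)%N (ltn_mod n 3) => [|[|[|//]]] // _ _.
  by rewrite -[RHS](chi3_sum3 m) addn1 addn2.
by rewrite -[RHS](chi3_sum3 m) addn1 addn2 addrAC.
Qed.

Lemma sum_binS (f : nat -> int) N L :
  \sum_(0 <= k < L.+1) 'C(N.+1, k)%:R * f k =
  \sum_(0 <= k < L.+1) 'C(N, k)%:R * f k + \sum_(0 <= k < L) 'C(N, k)%:R * f k.+1.
Proof.
rewrite !(big_nat_recl L) // !bin0 -addrA; congr (_ + _).
by rewrite -big_split; apply: eq_bigr => k _; rewrite binS natrD mulrDl.
Qed.

(** For a primitive cube root of unity [w], [chi3] is a combination of [w^k] and [w^(-k)], and
    [(1+w)^N = (-1)^N w^(2N)]. The induction uses only Pascal's rule and [chi3_sum3]. *)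
Lemma sum_bin_chi3 N m :
  \sum_(0 <= k < N.+1) 'C(N, k)%:R * chi3 (m + k) = (-1) ^+ N * chi3 (m + 2 * N).
Proof.
elim: N m => [|N IHN] m; first by rewrite big_nat1 bin0 !mul1r.
rewrite sum_binS big_nat_recr //= bin_small // mul0r addr0 -big_split /=.
have E k : 'C(N, k)%:R * chi3 (m + k) + 'C(N, k)%:R * chi3 (m + k.+1)
   = - ('C(N, k)%:R * chi3 (m.+2 + k)).
  rewrite -mulrDr addnS !addSn -mulrN; congr (_ * _).
  by apply/eqP; rewrite -addr_eq0; apply/eqP/chi3_sum3.
rewrite (eq_bigr _ (fun k _ => E k)) sumrN IHN exprS mulN1r mulNr.
by congr (- (_ * chi3 _)); lia.
Qed.

(** The series of [chi3] is [X / (1+X+X^2)]. Since [(1+X)^2 = X + (1+X+X^2)], passing from [n] to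
    [n+1] adds the coefficient of [X^n] in [(1+X)^(2n)], which is the next summand. *)
Lemma sum_central_bin n :
  \sum_(0 <= k < n) 'C(2 * k, k)%:R
    = \sum_(0 <= k < n.+1) 'C(2 * n, k)%:R * chi3 (n - k).
Proof.
elim: n => [|n IHn]; first by rewrite big_geq // big_nat1.
rewrite big_nat_recr //= {}IHn mulnS add2n sum_binS !sum_binS.
rewrite (big_nat_recr n.+1) //= subnn mulr0 addr0.
rewrite !(big_nat_recr n) //= !subnn subSnn.
rewrite (_ : chi3 0 = 0) // (_ : chi3 1 = 1) // !mulr0 !addr0 mulr1.
pose S j := \sum_(0 <= k < n) 'C(2 * n, k)%:R * chi3 (n.+1 - (k + j)).
suff E : S 1%N = S 0%N + S 1%N + (S 1%N + S 2%N).
  transitivity (S 1%N + 'C(2 * n, n)%:R).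
    by congr (_ + _); apply: eq_bigr => k _; rewrite addn1 subSS.
  rewrite E addrAC; congr (_ + _); last first.
    congr (_ + _); apply: eq_bigr => k _; rewrite ?addn1 ?addn2 //.
  rewrite addrAC; congr (_ + _ + _); apply: eq_bigr => k _.
    by rewrite addn0.
  by rewrite addn1.
rewrite -!big_split /=.
apply: eq_big_nat => k /andP[_ lt_kn].
rewrite -!mulrDr; congr (_ * _).
have [d ->] : exists d, n = (d + k.+1)%N by exists (n - k.+1)%N; lia.
have -> : ((d + k.+1).+1 - (k + 0) = d.+2)%N by lia.
have -> : ((d + k.+1).+1 - (k + 1) = d.+1)%N by lia.
have -> : ((d + k.+1).+1 - (k + 2) = d)%N by lia.
have := chi3_sum3 d; lia.
Qed.

(** * Coefficient extraction and the sums modulo p^2 *)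

(* The coefficient of X^M in F(X) * \sum_k chi3 k X^k. *)
Definition chi3_coef (M : nat) (F : {poly int}) : int :=
  \sum_(0 <= k < M.+1) F`_k * chi3 (M - k).

Lemma chi3_coefD M F G : chi3_coef M (F + G) = chi3_coef M F + chi3_coef M G.
Proof.
by rewrite -big_split /=; apply: eq_bigr => k _; rewrite coefD mulrDl.
Qed.

Lemma chi3_coefMn M F n : chi3_coef M (F *+ n) = chi3_coef M F *+ n.
Proof.
by rewrite -sumrMnl; apply: eq_bigr => k _; rewrite coefMn mulrnAl.
Qed.

Lemma chi3_coef0 F : chi3_coef 0 F = 0.
Proof. by rewrite /chi3_coef big_nat1 mulr0. Qed.

Lemma chi3_coef_shift n M F : chi3_coef (n + M) ('X^n * F) = chi3_coef M F.
Proof.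
rewrite /chi3_coef -addnS (big_cat_nat (n := n)) ?leq_addr //=.
rewrite big_nat_cond big1 ?add0r => [|k /andP[/andP[_ lt_kn] _]]; last first.
  by rewrite coefXnM lt_kn mul0r.
rewrite -{1}(add0n n) big_addn addnC addnK; apply: eq_bigr => k _.
by rewrite coefXnM ltnNge leq_addl addnK addnC subnDr.
Qed.

Lemma chi3_coef1 M : chi3_coef M 1 = chi3 M.
Proof.
rewrite /chi3_coef big_nat_recl // subn0 coef1 mul1r big1 ?addr0 // => k _.
by rewrite coef1 mul0r.
Qed.

Lemma coef_1DXn N k : ((1 + 'X) ^+ N)`_k = 'C(N, k)%:R :> int.
Proof.
elim: N k => [|N IHN] k; first by rewrite expr0 coef1 bin0n eq_sym.
rewrite exprS mulrDl mul1r coefD coefXM !IHN; case: k => [|k] /=.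
  by rewrite !bin0 addr0.
by rewrite binS natrD.
Qed.

Lemma chi3_coef_bin n :
  \sum_(0 <= k < n) 'C(2 * k, k)%:R = chi3_coef n ((1 + 'X) ^+ (2 * n)).
Proof.
by rewrite sum_central_bin; apply: eq_bigr => k _; rewrite coef_1DXn.
Qed.

Lemma expr_1DX_prime p : prime p ->
  exists G : {poly int}, (1 + 'X) ^+ p = 1 + 'X^p + G *+ p.
Proof.
move=> p_pr; have p_gt0 := prime_gt0 p_pr.
exists (\poly_(k < p) (if k == 0%N then 0 else ('C(p, k) %/ p)%:R)).
apply/polyP => k; rewrite coef_1DXn !coefD coef1 coefXn coefMn coef_poly.
case: (ltngtP k p) => [lt_kp|lt_pk|->].
- case: eqP => [->|/eqP k_neq0]; first by rewrite bin0 !addr0 mul0rn addr0.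
  rewrite !add0r -mulrnA divnK // prime_dvd_bin // lt_kp lt0n k_neq0 //.
- by rewrite bin_small // mul0rn gtn_eqF // (leq_trans _ lt_pk).
- by rewrite binn mul0rn gtn_eqF.
Qed.

(** In degree [p + m] the power [(1+X)^p] gives [- chi3 (m + 2p)], while [1] and [X^p] give
    [chi3 (p + m)] and [chi3 m]. These three character values add up to 0. Thus the part divisible
    by [p] drops out to first order, which yields congruences modulo [p ^ 2]. *)
Lemma chi3_coef_prime_part p m G : prime p -> (5 <= p)%N ->
  (1 + 'X) ^+ p = 1 + 'X^p + G -> chi3_coef (p + m) G = 0.
Proof.
move=> p_pr p_ge5 DG.
have p_odd : odd p by case: (even_prime p_pr) => [Dp|//]; rewrite Dp in p_ge5.
have p_n3 : ~~ (3 %| p)%N.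
  by rewrite dvdn_prime2 //; apply/eqP => Dp; rewrite -Dp in p_ge5.
have /esym : chi3_coef (p + m) ((1 + 'X) ^+ p) = - chi3 (m + 2 * p).
  transitivity (\sum_(0 <= k < p.+1) 'C(p, k)%:R * chi3 (p + m - k)).
    rewrite /chi3_coef; under eq_bigr do rewrite coef_1DXn.
    apply: sum_nat_widen0 => [|k lt_pk]; first by rewrite ltnS leq_addr.
    by rewrite bin_small ?mul0r.
  rewrite big_nat_rev /= add0n.
  have -> : - chi3 (m + 2 * p) = (-1) ^+ p * chi3 (m + 2 * p).
    by rewrite -signr_odd p_odd expr1 mulN1r.
  rewrite -sum_bin_chi3; apply: eq_big_nat => k /andP[_ lt_kp].
  by rewrite subSS bin_sub //; congr (_ * chi3 _); lia.
rewrite DG !chi3_coefD chi3_coef1 -['X^p]mulr1 chi3_coef_shift chi3_coef1 => E.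
have := chi3_sum_mul3 m p p_n3; rewrite (addnC m p); lia.
Qed.

(** Expand [(1 + X^p + E)^2] with [E = p G]. In degree [p] the multiples of [X^p] only meet
    [chi3 0 = 0], the term [2E] vanishes, and [E^2] is a multiple of [p^2]. *)
Lemma sum_central_bin_prime p : prime p -> (5 <= p)%N ->
  exists s : int, \sum_(0 <= k < p) 'C(2 * k, k)%:R = chi3 p + s *+ p ^ 2.
Proof.
move=> p_pr p_ge5; have [G DG] := expr_1DX_prime p p_pr.
have E0 := chi3_coef_prime_part p 0 _ p_pr p_ge5 DG.
exists (chi3_coef p (G ^+ 2)).
rewrite chi3_coef_bin mulnC exprM DG.
have -> : (1 + 'X^p + G *+ p) ^+ 2 =
  1 + 'X^p * (2 + 'X^p + 2 * (G *+ p)) + (G *+ p) *+ 2 + (G ^+ 2) *+ p ^ 2.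
  by rewrite -exprMn_n; ring.
rewrite !chi3_coefD !chi3_coefMn chi3_coef1; rewrite addn0 in E0.
rewrite -chi3_coefMn E0 -{2}[p]addn0 chi3_coef_shift chi3_coef0.
by rewrite !addr0.
Qed.

Lemma sum_central_bin_2prime p : prime p -> (5 <= p)%N ->
  exists s : int,
    \sum_(0 <= k < 2 * p) 'C(2 * k, k)%:R = 3 * chi3 p + s *+ p ^ 2.
Proof.
move=> p_pr p_ge5; have [G DG] := expr_1DX_prime p p_pr.
have p_n3 : ~~ (3 %| p)%N.
  by rewrite dvdn_prime2 //; apply/eqP => Dp; rewrite -Dp in p_ge5.
have E0 := chi3_coef_prime_part p 0 _ p_pr p_ge5 DG; rewrite addn0 in E0.
have E1 := chi3_coef_prime_part p p _ p_pr p_ge5 DG.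
exists (chi3_coef (p + p) (G ^+ 2 *
  ((1 + 'X^p) ^+ 2 *+ 6 + (1 + 'X^p) * (G *+ p) *+ 4 + (G *+ p) ^+ 2))).
rewrite chi3_coef_bin (_ : 2 * (2 * p) = p * 4)%N; last lia.
rewrite exprM DG mul2n -addnn.
move: E0 E1; set E := G *+ p => E0 E1.
have E2 : E ^+ 2 = G ^+ 2 *+ p ^ 2 by rewrite /E exprMn_n.
clearbody E.
(* Sorted by powers of [X^p]. Up to the [E^2] part, in degree [2p] only [1] and [4 X^p] survive,
   giving [chi3 (2p) + 4 chi3 p = 3 chi3 p]. *)
have -> : (1 + 'X^p + E) ^+ 4 = 1 + E *+ 4
    + 'X^p * (1 *+ 4 + E *+ 12
              + 'X^p * (6 + 'X^p *+ 4 + 'X^p ^+ 2 + E *+ 12 + 'X^p * E *+ 4))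
    + E ^+ 2 * ((1 + 'X^p) ^+ 2 *+ 6 + (1 + 'X^p) * E *+ 4 + E ^+ 2).
  by ring.
rewrite {1}E2 mulrnAl !(chi3_coefD, chi3_coefMn) chi3_coef1 E1.
rewrite chi3_coef_shift !(chi3_coefD, chi3_coefMn) chi3_coef1 E0.
have := chi3_coef_shift p 0; rewrite addn0 => ->; rewrite chi3_coef0 !mul0rn.
move: (_ *+ p ^ 2) => x.
have := chi3_sum_mul3 0 p p_n3; rewrite !add0n mul2n -addnn (_ : chi3 0 = 0) //.
lia.
Qed.

(** * Products of integers modulo p^2 *)

(** Quantifying [a] and [b] before [k] makes them common to all the points [k p], as interpolation
    requires. *)
Lemma prod_addM_affine (p : int) (s : seq nat) : exists a b : int, forall k : int,
  exists e : int, \prod_(t <- s) (k * p + t%:Z) = a + b * k * p + p ^+ 2 * e.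
Proof.
elim: s => [|t s [a [b IHs]]].
  by exists 1, 0 => k; exists 0; rewrite big_nil; ring.
exists (t%:Z * a), (a + t%:Z * b) => k; have [e E] := IHs k.
exists (b * k ^+ 2 + k * p * e + t%:Z * e); rewrite big_cons E; ring.
Qed.

(* 1, -3, 2 are the weights annihilating both 1 and x at x = p, -p, -2p. *)
Lemma prod_add_interpolation (p : int) (s : seq nat) : exists e : int,
  \prod_(t <- s) (p + t%:Z) =
    3 * \prod_(t <- s) (t%:Z - p) - 2 * \prod_(t <- s) (t%:Z - 2 * p) + p ^+ 2 * e.
Proof.
have [a [b E]] := prod_addM_affine p s.
have [e1 E1] := E 1; have [e2 E2] := E (-1); have [e3 E3] := E (- 2).
exists (e1 - 3 * e2 + 2 * e3).
have -> : \prod_(t <- s) (p + t%:Z) = a + b * 1 * p + p ^+ 2 * e1.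
  by rewrite -E1; apply: eq_bigr => t _; rewrite mul1r.
have -> : \prod_(t <- s) (t%:Z - p) = a + b * (-1) * p + p ^+ 2 * e2.
  by rewrite -E2; apply: eq_bigr => t _; rewrite mulN1r addrC.
have -> : \prod_(t <- s) (t%:Z - 2 * p) = a + b * (-2) * p + p ^+ 2 * e3.
  by rewrite -E3; apply: eq_bigr => t _; rewrite mulNr addrC.
ring.
Qed.

Lemma prod_sqr_sub (p : int) (i : nat) : exists e : int,
  \prod_(1 <= t < i.+1) (p ^+ 2 - t%:Z ^+ 2)
    = (-1) ^+ i * (i`!%:Z) ^+ 2 + p ^+ 2 * e.
Proof.
elim: i => [|i [e IHi]]; first by exists 0; rewrite big_geq // fact0; ring.
exists ((-1) ^+ i * i`!%:Z ^+ 2 + (p ^+ 2 - i.+1%:Z ^+ 2) * e).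
by rewrite big_nat_recr //= IHi factS PoszM (exprS (-1)); ring.
Qed.

Lemma prod_sub_ffact (N k m : nat) : (k < N)%N ->
  \prod_(k.+1 <= t < (k + m).+1) (t%:Z - N%:Z) = (-1) ^+ m * ((N - k.+1) ^_ m)%:Z.
Proof.
move=> lt_kN; elim: m => [|m IHm]; first by rewrite addn0 big_geq.
rewrite addnS big_nat_recr ?ltnS ?leq_addr //= {}IHm ffactnSr PoszM (exprS (-1)).
have [le_m | lt_m] := leqP m (N - k.+1).
  by rewrite -subzn // -subzn //; have -> : (k + m).+1%:Z = k.+1%:Z + m%:Z by []; ring.
by rewrite ffact_small // mul0r !mulr0 mul0r.
Qed.

(** * Rationals integral at p *)

Definition p_integral (p : nat) : {pred rat} := [pred x | coprimez (denq x) p].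

Lemma p_integral_frac p (n d : int) : prime p ->
  coprimez d p -> n%:~R / d%:~R \in p_integral p.
Proof.
move=> p_pr cop_dp; have d_neq0 : d != 0.
  apply: contraTneq cop_dp => ->; rewrite /coprimez gcd0z.
  by rewrite eqz_nat; case: (p) p_pr => [|[]].
set x := _ / _; rewrite inE.
have Dx : numq x * d = n * denq x.
  apply: (@intr_inj rat); rewrite !intrM.
  have : x * d%:~R = n%:~R by apply: divfK; rewrite intr_eq0.
  rewrite -{1}(divq_num_den x) => <-.
  by rewrite [RHS]mulrAC divfK ?intr_eq0 ?denq_neq0.
have : (denq x %| numq x * d)%Z by rewrite Dx dvdz_mull.
rewrite Gauss_dvdzr; last by rewrite coprimezE coprime_sym coprime_num_den.
by case/dvdzP => q Dd; move: cop_dp; rewrite Dd coprimezMl => /andP[].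
Qed.

Lemma p_integralP p (x : rat) : prime p -> reflect
  (exists n d : int, [/\ coprimez d p, d%:~R != 0 :> rat & x = n%:~R / d%:~R])
  (x \in p_integral p).
Proof.
move=> p_pr; apply: (iffP idP) => [x_int | [n [d [cop_d _ ->]]]]; last first.
  exact: p_integral_frac.
exists (numq x), (denq x); rewrite divq_num_den intr_eq0 denq_neq0; split=> //.
Qed.

Lemma p_integral_int p (n : int) : n%:~R \in p_integral p.
Proof. by rewrite inE denq_int /coprimez gcd1z. Qed.

Lemma p_integralD p x y : prime p ->
  x \in p_integral p -> y \in p_integral p -> x + y \in p_integral p.
Proof.
move=> p_pr /(p_integralP _ _ p_pr)[n [d [cd dn0 ->]]].
move=> /(p_integralP _ _ p_pr)[m [e [ce en0 ->]]].
rewrite addf_div // -!intrM -intrD; apply: p_integral_frac => //.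
by rewrite coprimezMl cd.
Qed.

Lemma p_integralM p x y : prime p ->
  x \in p_integral p -> y \in p_integral p -> x * y \in p_integral p.
Proof.
move=> p_pr /(p_integralP _ _ p_pr)[n [d [cd dn0 ->]]].
move=> /(p_integralP _ _ p_pr)[m [e [ce en0 ->]]].
rewrite mulf_div -!intrM; apply: p_integral_frac => //.
by rewrite coprimezMl cd.
Qed.

Lemma p_integralX p x n : prime p -> x \in p_integral p -> x ^+ n \in p_integral p.
Proof.
move=> p_pr x_int; elim: n => [|n IHn]; first exact: (p_integral_int p 1).
by rewrite exprS p_integralM.
Qed.

Lemma p_integralV p (n : nat) :
  prime p -> coprime n p -> n%:R^-1 \in p_integral p.
Proof.
by move=> p_pr cop_n; rewrite -[_^-1]mul1r; apply: (p_integral_frac p 1 n).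
Qed.

Lemma p_integral_factV p (n : nat) :
  prime p -> (n < p)%N -> n`!%:R^-1 \in p_integral p.
Proof.
move=> p_pr lt_np; apply: p_integralV => //; elim: n lt_np => [|n IHn] lt_np.
  by rewrite fact0 coprime1n.
rewrite factS coprimeMl IHn 1?ltnW // andbT coprime_sym prime_coprime //.
by rewrite gtnNdvd.
Qed.

Lemma sum_congr_p_integral p (x : rat) (F G : nat -> rat) n : prime p ->
  (forall i, (i < n)%N -> exists2 c, c \in p_integral p & F i = G i + x * c) ->
  exists2 c, c \in p_integral p &
    \sum_(0 <= i < n) F i = \sum_(0 <= i < n) G i + x * c.
Proof.
move=> p_pr; elim: n => [|n IHn] FG.
  by exists 0; rewrite ?(p_integral_int p 0) // !big_geq // mulr0 addr0.
have [i lt_in|c c_int E] := IHn; first exact/FG/ltnW.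
have [//|d d_int En] := FG n; exists (c + d); first exact: p_integralD.
by rewrite !big_nat_recr //= E En; ring.
Qed.

(** * The quadratic character of -3 *)

Lemma sqr_eqN3_Fp p (x : nat) : prime p ->
  (((x%:Z) ^+ 2 == -3 %[mod p])%Z) = (x%:R ^+ 2 == -3 :> 'F_p).
Proof.
move=> p_pr; rewrite eqz_mod_dvd opprK -[RHS]subr_eq0 opprK.
have -> : x%:Z ^+ 2 + 3 = (x ^ 2 + 3)%N :> int by rewrite PoszD -rmorphXn.
rewrite dvdzE /= -natrX -natrD (dvdn_pcharf (pchar_Fp p_pr)) //.
Qed.

(** As [- 3 = (2w+1)^2] for a root [w] of [w^2 + w + 1], the question is whether the field contains
    a primitive cube root of unity, that is, whether 3 divides [p - 1]. *)
Lemma Fp_sqr_eqN3 p : prime p -> (5 <= p)%N ->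
  [exists x : 'F_p, x ^+ 2 == -3] = (p %% 3 == 1)%N.
Proof.
move=> p_pr p_ge5.
have Fp_nat_neq0 k : (0 < k < 5)%N -> k%:R != 0 :> 'F_p.
  by case/andP=> k_gt0 lt_k5; rewrite -(dvdn_pcharf (pchar_Fp p_pr)) gtnNdvd //; lia.
have cardF : #|'F_p| = p by rewrite card_Fp.
have two_neq0 := Fp_nat_neq0 2%N isT; have three_neq0 := Fp_nat_neq0 3%N isT.
have fermat (x : 'F_p) : x ^+ p = x by rewrite -{2}(expf_card x) cardF.
apply/existsP/eqP => [[x /eqP Dx] | p_mod3].
  (* A square root of -3 gives the primitive cube root of unity (x - 1) / 2. *)
  pose w := (x - 1) / 2%:R.
  have w_root : w ^+ 2 + w + 1 = 0.
    have -> : w ^+ 2 + w + 1 = (x ^+ 2 + 3) / 4%:R.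
      by rewrite /w; field; rewrite two_neq0 Fp_nat_neq0.
    by rewrite Dx addNr mul0r.
  have w3 : w ^+ 3 = 1.
    apply: subr0_eq; transitivity ((w - 1) * (w ^+ 2 + w + 1)); first by ring.
    by rewrite w_root mulr0.
  have w_neq1 : w != 1.
    by apply: contra_eq_neq w_root => ->; rewrite expr1n -mulr2n natr1.
  have w_neq0 : w != 0.
    by apply: contra_eq_neq w3 => ->; rewrite expr0n eq_sym oner_eq0.
  (* This follows from [w ^ 3 = 1] and [w ^ p = w]. Remainder 0 would give [p = 3], and remainder 2
     would give [w = 1]. *)
  have : w ^+ (p %% 3) = w.
    rewrite -[RHS]fermat; transitivity (w ^+ (p %/ 3 * 3 + p %% 3)).
      by rewrite exprD mulnC exprM w3 expr1n mul1r.
    by rewrite -divn_eq.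
  have := ltn_mod p 3; case Dp: (p %% 3)%N => [|[|[|//]]] // _.
    have : (3 %| p)%N by rewrite /dvdn Dp.
    by rewrite dvdn_prime2 // => /eqP Dp3; rewrite -Dp3 in p_ge5.
  by move=> E; case/eqP: w_neq1; apply: (mulfI w_neq0); rewrite mulr1.
set m := (p %/ 3)%N.
have Dp : p = (m * 3).+1 by rewrite {1}(divn_eq p 3) p_mod3 addn1.
have m_gt0 : (0 < m)%N by lia.
(* [X^m - 1] has at most [m] roots, fewer than the [p - 1] nonzero elements; [y ^ m] is then a
   primitive cube root of unity. *)
have [y [y_neq0 ym_neq1]] : exists y : 'F_p, y != 0 /\ y ^+ m != 1.
  case: (pickP [pred y : 'F_p | (y != 0) && (y ^+ m != 1)]) => [y /andP[]|none].
    by exists y.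
  pose P : {poly 'F_p} := 'X^m - 1; pose s := enum (predC1 (0 : 'F_p)).
  have : (size s < size P)%N.
    apply: max_poly_roots.
    - by rewrite -size_poly_eq0 size_XnsubC.
    - apply/allP => y; rewrite mem_enum inE => y_neq0.
      rewrite rootE !hornerE subr_eq0.
      by have := none y; rewrite /= y_neq0 => /negbFE.
    - exact: enum_uniq.
  rewrite /P size_XnsubC // -cardE -(leq_add2l 1); have := cardC1 (0 : 'F_p).
  rewrite cardF => ->; lia.
pose w := y ^+ m.
have w3 : w ^+ 3 = 1.
  rewrite -exprM; apply: (mulfI y_neq0); rewrite -exprS -Dp fermat mulr1 //.
have w_root : w ^+ 2 + w + 1 = 0.
  have : (w - 1) * (w ^+ 2 + w + 1) = 0 by rewrite -[RHS](subrr 1) -{3}w3; ring.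
  by move/eqP; rewrite mulf_eq0 subr_eq0 (negbTE ym_neq1) => /eqP.
exists (2 * w + 1); apply/eqP.
transitivity (4 * (w ^+ 2 + w + 1) - 3); first by ring.
by rewrite w_root mulr0 sub0r.
Qed.

Lemma legendreN3 p : prime p -> (5 <= p)%N -> legendre (- 3) p = chi3 p.
Proof.
move=> p_pr p_ge5; rewrite /legendre /chi3.
have -> : (p %| -3)%Z = false by rewrite dvdzE gtnNdvd // (leq_trans _ p_ge5).
have -> : [exists x : 'I_p, ((x%:Z) ^+ 2 == -3 %[mod p])%Z]
    = [exists x : 'F_p, x ^+ 2 == -3].
  apply/existsP/existsP => [[x] | [x Dx]].
    by rewrite sqr_eqN3_Fp // => Dx; exists (x%:R).
  have lt_xp : (x < p)%N by rewrite -{2}(Fp_cast p_pr).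
  by exists (Ordinal lt_xp); rewrite sqr_eqN3_Fp //= natr_Zp.
rewrite Fp_sqr_eqN3 //.
case: eqP => // p_mod3_neq1; case: eqP => // p_mod3_neq2.
have : (3 %| p)%N by rewrite /dvdn; have := ltn_mod p 3; lia.
by rewrite dvdn_prime2 // => /eqP Dp; rewrite -Dp in p_ge5.
Qed.

(** * Assembly of the congruence modulo p^3 *)

Lemma prod_sub_trinomial_term N i : (i < N)%N ->
  27^-1 ^+ i * (\prod_(i.+1 <= t < (3 * i).+1) (t%:Z - N%:Z))%:~R / i`!%:R ^+ 2
    = 3^-1 ^+ N.-1 * trinomial_term N.-1 i.
Proof.
move=> lt_iN; have -> : (3 * i = i + 2 * i)%N by lia.
rewrite prod_sub_ffact // exprM sqrrN !expr1n mul1r trinomial_term_ffact.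
have -> : (N.-1 - i = N - i.+1)%N by lia.
rewrite !mulrA -exprMn mulVf // expr1n mul1r //.
Qed.

Lemma coprime3_prime p : prime p -> (5 <= p)%N -> coprime 3 p.
Proof.
move=> p_pr p_ge5; rewrite coprime_sym prime_coprime // gtnNdvd //.
exact: leq_trans p_ge5.
Qed.

(** Modulo [p^2] the first product cancels the sign and two of the four factors [i!]; the second is
    interpolated from its values at [- p] and [- 2p]. Since [i < p], the denominators are prime to
    [p]. *)
Lemma summand_congr p i : prime p -> (5 <= p)%N -> (i < p)%N ->
  exists2 c, c \in p_integral p &
  (- 27^-1) ^+ i * (\prod_(1 <= t < i.+1) (p%:R ^+ 2 - t%:R ^+ 2))
     * (\prod_(i.+1 <= t < (3 * i).+1) (p%:R + t%:R)) / i`!%:R ^+ 4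
  = (3 * 3^-1 ^+ p.-1 * trinomial_term p.-1 i
      - 2 * 3^-1 ^+ (2 * p).-1 * trinomial_term (2 * p).-1 i)
    + p%:R ^+ 2 * c.
Proof.
move=> p_pr p_ge5 lt_ip.
set U := \prod_(1 <= t < _) _; set W := \prod_(i.+1 <= t < _) _.
have [e1 E1] := prod_sqr_sub p i.
have [e2 E2] := prod_add_interpolation p (index_iota i.+1 (3 * i).+1).
have DU : U = (-1) ^+ i * i`!%:R ^+ 2 + p%:R ^+ 2 * e1%:~R.
  transitivity ((\prod_(1 <= t < i.+1) (p%:Z ^+ 2 - t%:Z ^+ 2))%:~R : rat).
    by rewrite rmorph_prod; apply: eq_bigr => t _; rewrite rmorphB !rmorphXn.
  by rewrite E1 rmorphD !rmorphM !rmorphXn /= rmorphN1.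
pose Z := \prod_(i.+1 <= t < (3 * i).+1) (p%:Z + t%:Z).
have DZ : W = Z%:~R.
  by rewrite rmorph_prod; apply: eq_bigr => t _; rewrite rmorphD.
have DW : 27^-1 ^+ i * W / i`!%:R ^+ 2 =
    3 * 3^-1 ^+ p.-1 * trinomial_term p.-1 i
      - 2 * 3^-1 ^+ (2 * p).-1 * trinomial_term (2 * p).-1 i
    + p%:R ^+ 2 * (27^-1 ^+ i * e2%:~R / i`!%:R ^+ 2).
  rewrite DZ /Z E2 -!mulrA -!prod_sub_trinomial_term //; last lia.
  rewrite (PoszM 2 p) intrD intrB !intrM.
  by ring.
have i_int := p_integral_factV _ _ p_pr lt_ip.
have inv27_int : 27^-1 \in p_integral p.
  apply: p_integralV => //; rewrite (_ : 27 = 3 ^ 3)%N // coprimeXl //.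
  exact: coprime3_prime.
(* The first summand is the interpolation error, the second the error from the product of the
   [p^2 - t^2]. *)
exists (27^-1 ^+ i * e2%:~R * i`!%:R^-1 ^+ 2
        + (-1) ^+ i * 27^-1 ^+ i * e1%:~R * Z%:~R * i`!%:R^-1 ^+ 4).
  have int1 := p_integral_int p.
  have M x y := p_integralM p x y p_pr; have X x n := p_integralX p x n p_pr.
  have w_int := X _ i inv27_int.
  apply: p_integralD => //; apply: (M _ _ _ (X _ _ i_int)).
    exact: (M _ _ w_int).
  apply: (M _ _ _ (int1 _)); apply: (M _ _ _ (int1 _)); apply: (M _ _ _ w_int).
  exact: (X _ _ (int1 (-1))).
rewrite DU -DZ -!exprVn in DW *.
have -> := canRL (addrK _) (esym DW).
have -> : (- 27^-1) ^+ i = (-1) ^+ i * 27^-1 ^+ i :> rat.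
  by rewrite -exprMn mulN1r.
have : (-1) ^+ i * (-1) ^+ i = 1 :> rat by rewrite -expr2 sqrr_sign.
have : i`!%:R * i`!%:R^-1 = 1 :> rat by rewrite mulfV ?natr_fact_neq0.
move: (i`!%:R) (i`!%:R^-1) ((-1) ^+ i) (27^-1 ^+ i) (p%:R) (e1%:~R) => f f' s w x e.
generalize W => y Ef Es.
transitivity (w * y * (s * s) * (f * f') ^+ 2 * f' ^+ 2
   + x ^+ 2 * (s * w * e * y * f' ^+ 4)); first by ring.
by rewrite Es Ef; ring.
Qed.

Lemma coprimez_denq_expn p x n :
  x \in p_integral p -> coprimez (denq x) (p ^ n)%N.
Proof. by rewrite inE !coprimezE => /(coprimeXr n). Qed.

Lemma inv3_fermat p : prime p -> (5 <= p)%N ->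
  exists2 v, v \in p_integral p & 3^-1 ^+ p.-1 = 1 + p%:R * v.
Proof.
move=> p_pr p_ge5.
have cop3 := coprime3_prime _ p_pr p_ge5.
have /eqP := Euler_exp_totient cop3; rewrite totient_prime //.
rewrite eqn_mod_dvd ?expn_gt0 // => /dvdnP[k Dk].
have inv3_int : 3^-1 \in p_integral p by exact: p_integralV.
(* With [3^(p-1) = 1 + p k] and [u = 3^(1-p)], the relation [u (1 + p k) = 1] gives
   [u = 1 - p k u]. *)
exists (- k%:R * 3^-1 ^+ p.-1).
  apply: p_integralM => //; last exact: p_integralX.
  have -> : - k%:R = (- k%:Z)%:~R :> rat by rewrite rmorphN.
  exact: p_integral_int.
have E : 3 ^+ p.-1 = 1 + p%:R * k%:R :> rat.
  by rewrite -natrM mulnC -Dk natrB ?expn_gt0 // natrX addrC subrK.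
have : 3 ^+ p.-1 * 3^-1 ^+ p.-1 = 1 :> rat by rewrite -exprMn mulfV // expr1n.
rewrite E; move: (3^-1 ^+ _) => u Eu; rewrite -[X in X + _]Eu; ring.
Qed.

Theorem theorem1p1 (p : nat) (p_prime : prime p) (p_ge5 : (5 <= p)%N) :
  rat_congr (p ^ 3)
    (\sum_(0 <= k < p) (4 * k + 1)%:R / 81 ^+ k * az_number k)
    ((legendre (- 3) p)%:~R * p%:R).
Proof.
rewrite legendreN3 // sum_az_number.
have p_gt0 := prime_gt0 p_prime.
have [c c_int ->] := sum_congr_p_integral _ _ _ _ _ p_prime
  (fun i => summand_congr p i p_prime p_ge5).
rewrite sumrB -!mulr_sumr.
have -> : \sum_(0 <= i < p) trinomial_term p.-1 i
    = (\sum_(0 <= k < p) 'C(2 * k, k)%:R : int)%:~R.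
  rewrite -{1}(prednK p_gt0) -/(trinomial_sum _) trinomial_sumE prednK //.
  by rewrite rmorph_sum; apply: eq_bigr => k _; rewrite rmorph_nat.
have -> : \sum_(0 <= i < p) trinomial_term (2 * p).-1 i
    = (\sum_(0 <= k < 2 * p) 'C(2 * k, k)%:R : int)%:~R.
  (* The terms with [j >= p] vanish because [3 j > 2 p - 1]. *)
  transitivity (trinomial_sum (2 * p).-1).
    apply/esym/sum_nat_widen0 => [|j le_pj]; first lia.
    by apply: trinomial_term_gt; lia.
  rewrite trinomial_sumE prednK; last lia.
  by rewrite rmorph_sum; apply: eq_bigr => k _; rewrite rmorph_nat.
have [s1 ->] := sum_central_bin_prime _ p_prime p_ge5.
have [s2 ->] := sum_central_bin_2prime _ p_prime p_ge5.
have [v v_int Du] := inv3_fermat _ p_prime p_ge5.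
have -> : -3 * (- 3^-1) ^+ p = 3^-1 ^+ p.-1 :> rat.
  have p_odd : odd p by case: (even_prime p_prime) p_ge5 => // ->.
  rewrite -{1}(prednK p_gt0) exprS mulrA mulrNN mulfV // mul1r.
  rewrite -mulN1r exprMn -signr_odd; move: p_odd.
  by rewrite -{1}(prednK p_gt0) /= => /negbTE->; rewrite mul1r.
(* The extra [3^-1] will cancel the 3 of [3 * chi3 p]. *)
have -> : 3^-1 ^+ (2 * p).-1 = (3^-1 ^+ p.-1) ^+ 2 * 3^-1 :> rat.
  by rewrite -exprM -exprSr; congr (_ ^+ _); lia.
have inv3_int : 3^-1 \in p_integral p by apply/p_integralV/coprime3_prime.
have int1 := p_integral_int p.
have castE (a s : int) :
    (a + s *+ p ^ 2)%:~R = a%:~R + s%:~R * p%:R ^+ 2 :> rat.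
  by rewrite intrD -[s *+ _]mulr_natr intrM rmorph_nat natrX.
rewrite !castE intrM.
move: (3^-1 ^+ p.-1) Du => u Du.
have D x y := p_integralD p x y p_prime; have M x y := p_integralM p x y p_prime.
have u_int : u \in p_integral p.
  by rewrite Du; apply: (D 1); [exact: (int1 1) | exact: (M _ _ (int1 p))].
have u2_int := p_integralX p _ 2 p_prime u_int.
(* The first line collects the [p^2] errors of the two binomial sums and of the summands. The second
   comes from [3u^2 - 2u^3 - 1 = - (1-u)^2 (2u+1)] with [1 - u = - p v]. *)
exists (u * (3 * u * s1%:~R + - 2 * u ^+ 2 * 3^-1 * s2%:~R + c)
        + - (chi3 p)%:~R * v ^+ 2 * (2 * u + 1)).
  rewrite natrX.
  have Ev : (1 - u) ^+ 2 = p%:R ^+ 2 * v ^+ 2 by rewrite Du; ring.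
  transitivity (p%:R * u * (3 * u * (s1%:~R * p%:R ^+ 2)
      - 2 * (u ^+ 2 / 3) * (s2%:~R * p%:R ^+ 2) + p%:R ^+ 2 * c)
     - p%:R * (chi3 p)%:~R * ((1 - u) ^+ 2 * (2 * u + 1))).
    by field.
  by rewrite Ev; field.
apply: coprimez_denq_expn; apply: (D).
  apply: (M _ _ u_int); apply: (D) => //; apply: (D).
    by apply: (M) => //; exact: (M _ _ (int1 3)).
  by apply: (M) => //; apply: (M) => //; exact: (M _ _ (int1 (-2))).
apply: (M).
  apply: (M); last exact: p_integralX.
  by rewrite -rmorphN; exact: int1.
by apply: (D); [exact: (M _ _ (int1 2)) | exact: (int1 1)].
Qed.
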